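(* For every positive integer $n$, $$\left\lfloor \zeta_n^*(1)^{-1}\right\rfloor=\begin{cases}-2n & \text{if } n\geq 2 \text{ is even},\\ 2n-1 & \text{if } n\geq 1 \text{ is odd}.\end{cases}$$
   Context: For a positive integer $n$ and $s$ with $\Re(s)>0$, $\zeta_n^*(s)=\sum_{k=n}^{\infty}\frac{(-1)^{k+1}}{k^s}$ (the limit of partial sums; the series may converge only conditionally, as for $s=1$) is the tail of the alternating Riemann zeta function. $\lfloor x\rfloor$ denotes the largest integer less than or equal to the real number $x$. *)

(* Defs.v *)
From Stdlib Require Import Reals ZArith Arith.
From Coquelicot Require Import Coquelicot.

Open Scope R_scope.

(* k ^ s = exp (s * ln k), with the exponential of a complex number written out
   through its modulus and argument.  Meaningful only for k > 0, as ln 0 is a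
   default value. *)
Definition natCpow (k : nat) (s : C) : C :=
  (exp (Re s * ln (INR k)) * cos (Im s * ln (INR k)),
   exp (Re s * ln (INR k)) * sin (Im s * ln (INR k))).

Definition alt_zeta_term (s : C) (k : nat) : C :=
  ((- RtoC 1) ^ (k + 1) / natCpow k s)%C.

(* [is_series] is convergence of the partial sums, so conditional convergence
   is allowed. *)
Definition is_alt_zeta_tail (n : nat) (s z : C) : Prop :=
  is_series (fun j : nat => alt_zeta_term s (n + j)) z.

(* Main.v *)
(** Grouping the terms in pairs, the tail is up to sign the sum over
    [m = n, n+2, n+4, ...] of [1/m - 1/(m+1)].  Each such term lies strictly
    between [g m - g (m+2)] for [g m = 1/(2m)] and for [g m = 1/(2m-1)], so by
    telescoping the sum lies strictly between [1/(2n)] and [1/(2n-1)]. *)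
Require Import Defs.
From Stdlib Require Import Reals ZArith Arith.
From Stdlib Require Import Lra Lia.
From Coquelicot Require Import Coquelicot.

Lemma is_series_RtoC (a : nat -> R) (l : R) :
  is_series a l -> is_series (fun j => RtoC (a j)) (RtoC l).
Proof.
intros H.
unfold is_series.
apply filterlim_ext with (fun N => RtoC (sum_n a N)).
- intros N; induction N as [|N IH].
  + now rewrite !sum_O.
  + rewrite !sum_Sn, <- IH.
    unfold plus; simpl; unfold Cplus, RtoC; simpl.
    f_equal; ring.
- intros P [eps HP].
  destruct (H (ball l eps) (locally_ball l eps)) as [N HN].
  exists N; intros k Hk; apply HP.
  (* Balls in [C] are products of balls, and the imaginary coordinate already sits at its limit
     0. *)
  split; [exact (HN k Hk) | apply ball_center].
Qed.

Lemma alt_zeta_term_1 (k : nat) :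
  (0 < k)%nat -> alt_zeta_term (RtoC 1) k = RtoC ((-1) ^ (k + 1) / INR k).
Proof.
intros Hk.
assert (Hk' : 0 < INR k) by now apply lt_0_INR.
assert (natCpow k (RtoC 1) = RtoC (INR k)) as E.
{ unfold natCpow, RtoC; simpl.
  rewrite Rmult_1_l, Rmult_0_l, cos_0, sin_0, exp_ln by assumption.
  f_equal; ring. }
unfold alt_zeta_term.
now rewrite E, <- RtoC_opp, <- RtoC_pow, <- RtoC_div by lra.
Qed.

(** Leibniz's criterion, as [1/(n+j)] decreases to 0 in [j]. The sign is normalised so that the
    leading term is positive whatever the parity of [n]. *)
Lemma ex_series_alt_harmonic_tail (n : nat) :
  (0 < n)%nat -> exists l : R, is_series (fun j => (-1) ^ j / INR (n + j)) l.
Proof.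
intros Hn.
destruct (alternated_series (fun j => / INR (n + j))) as [l Hl].
- intros j; apply Rinv_le_contravar; [apply lt_0_INR | apply le_INR]; lia.
- apply is_lim_seq_Reals.
  apply is_lim_seq_ext with (fun j => / INR (j + n)).
  { intros j; now rewrite Nat.add_comm. }
  apply (is_lim_seq_incr_n (fun j => / INR j)).
  apply (is_lim_seq_inv INR p_infty); [apply is_lim_seq_INR | discriminate].
- exists l; apply is_series_Reals; exact Hl.
Qed.

Section Telescoping.

Variables (n : nat) (l : R) (g : R -> R).
Hypothesis n_gt0 : (0 < n)%nat.
Hypothesis Hl : is_series (fun j => (-1) ^ j / INR (n + j)) l.
Hypothesis Hg : is_lim_seq (fun k => g (INR k)) 0.

(** [sum_n] includes its upper index, so this takes [N + 1] full pairs; [g] at the first index left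
    out serves as an estimate of the remainder. *)
Let u (N : nat) : R :=
  sum_n (fun j => (-1) ^ j / INR (n + j)) (S (2 * N))
  + g (INR (n + 2 * N + 2)).

Lemma telescope_lim : is_lim_seq u l.
Proof.
replace (Finite l) with (Finite (l + 0)) by (f_equal; ring).
apply is_lim_seq_plus'.
- apply (is_lim_seq_subseq _ _ (fun N => S (2 * N))).
  + apply eventually_subseq; intros; lia.
  + exact Hl.
- apply (is_lim_seq_subseq (fun k => g (INR k)) _ (fun N => n + 2 * N + 2)%nat).
  + apply eventually_subseq; intros; lia.
  + exact Hg.
Qed.

(** Since [n + x] terms enter in pairs starting at an even offset, the new pair has signs plus,
    minus. The sign of the increment thus reduces to comparing one pair with one telescoping
    difference of [g]. *)
Lemma telescope_step (N : nat) (x := INR (n + 2 * N + 2)) :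
  u (S N) - u N = / x - / (x + 1) - (g x - g (x + 2)).
Proof.
unfold u.
replace (S (2 * S N)) with (S (S (S (2 * N)))) by lia.
rewrite (sum_Sn _ (S (S (2 * N)))), (sum_Sn _ (S (2 * N))).
change (@plus R_AbelianMonoid) with Rplus.
replace (n + S (S (2 * N)))%nat with (n + 2 * N + 2)%nat by lia.
replace (n + S (S (S (2 * N))))%nat with (S (n + 2 * N + 2)) by lia.
replace (n + 2 * S N + 2)%nat with (S (S (n + 2 * N + 2))) by lia.
rewrite !S_INR; fold x.
replace ((-1) ^ S (S (2 * N))) with 1
  by (replace (S (S (2 * N))) with (2 * S N)%nat by lia; now rewrite pow_1_even).
replace ((-1) ^ S (S (S (2 * N)))) with (-1)
  by (replace (S (S (S (2 * N)))) with (S (2 * S N)) by lia; now rewrite pow_1_odd).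
replace (x + 1 + 1) with (x + 2) by ring.
unfold Rdiv; ring.
Qed.

Lemma telescope_0 : u 0 = / INR n - / (INR n + 1) + g (INR n + 2).
Proof.
unfold u.
replace (2 * 0)%nat with 0%nat by lia.
rewrite sum_Sn, sum_O.
change (@plus R_AbelianMonoid) with Rplus.
replace (n + 0 + 2)%nat with (S (S n)) by lia.
replace (n + 1)%nat with (S n) by lia.
rewrite Nat.add_0_r, !S_INR.
replace (INR n + 1 + 1) with (INR n + 2) by ring.
unfold Rdiv; simpl; ring.
Qed.

(** The hypothesis makes [u] increasing, so its limit [l] is at least [u 0]. Passing to the limit
    loses strictness; applying the hypothesis once more, to the first pair [x = n], recovers it
    through [g n < u 0]. *)
Lemma telescope_gt :
  (forall x, 1 <= x -> g x - g (x + 2) < / x - / (x + 1)) -> g (INR n) < l.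
Proof.
intros H.
assert (Hn : 1 <= INR n) by (apply (le_INR 1); lia).
assert (H0 : u 0 <= l).
{ apply (is_lim_seq_incr_compare u); [exact telescope_lim |].
  intros N; generalize (telescope_step N).
  specialize (H (INR (n + 2 * N + 2))).
  assert (1 <= INR (n + 2 * N + 2)) by (apply (le_INR 1); lia).
  specialize (H ltac:(assumption)); lra. }
rewrite telescope_0 in H0.
specialize (H _ Hn); lra.
Qed.

Lemma telescope_lt :
  (forall x, 1 <= x -> / x - / (x + 1) < g x - g (x + 2)) -> l < g (INR n).
Proof.
intros H.
assert (Hn : 1 <= INR n) by (apply (le_INR 1); lia).
assert (H0 : l <= u 0).
{ apply (is_lim_seq_decr_compare u); [exact telescope_lim |].
  intros N; generalize (telescope_step N).
  specialize (H (INR (n + 2 * N + 2))).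
  assert (1 <= INR (n + 2 * N + 2)) by (apply (le_INR 1); lia).
  specialize (H ltac:(assumption)); lra. }
rewrite telescope_0 in H0.
specialize (H _ Hn); lra.
Qed.

End Telescoping.

Lemma is_lim_seq_inv_affine (c : R) :
  is_lim_seq (fun k => / (2 * INR k + c)) 0.
Proof.
apply (is_lim_seq_inv (fun k => 2 * INR k + c) p_infty); [| discriminate].
apply is_lim_seq_plus with p_infty c.
- apply is_lim_seq_ext with (fun k => INR (2 * k)).
  { intros k; now rewrite mult_INR. }
  apply (is_lim_seq_subseq INR p_infty (fun k => 2 * k)%nat).
  + apply eventually_subseq; intros; lia.
  + apply is_lim_seq_INR.
- apply is_lim_seq_const.
- reflexivity.
Qed.

Lemma alt_harmonic_tail_bounds (n : nat) (l : R) :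
  (0 < n)%nat -> is_series (fun j => (-1) ^ j / INR (n + j)) l ->
  / (2 * INR n) < l < / (2 * INR n - 1).
Proof.
intros Hn Hl; split.
- rewrite <- (Rplus_0_r (2 * INR n)).
  apply (telescope_gt n l (fun x => / (2 * x + 0)) Hn Hl (is_lim_seq_inv_affine 0)).
  intros x Hx.
  replace (/ (2 * x + 0) - / (2 * (x + 2) + 0)) with (/ (x * (x + 2)))
    by (field; lra).
  replace (/ x - / (x + 1)) with (/ (x * (x + 1))) by (field; lra).
  (* It remains to see that [x(x+1) < x(x+2)]. *)
  apply Rinv_lt_contravar; [| nra].
  repeat apply Rmult_lt_0_compat; lra.
- apply (telescope_lt n l (fun x => / (2 * x + -1)) Hn Hl (is_lim_seq_inv_affine (-1))).
  intros x Hx.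
  replace (/ (2 * x + -1) - / (2 * (x + 2) + -1))
    with (/ ((2 * x - 1) * (2 * x + 3) / 4)) by (field; lra).
  replace (/ x - / (x + 1)) with (/ (x * (x + 1))) by (field; lra).
  (* Here [(2x-1)(2x+3)/4 = x(x+1) - 3/4], just below [x(x+1)]. *)
  apply Rinv_lt_contravar; [| nra].
  apply Rmult_lt_0_compat; nra.
Qed.

Theorem theorem1p1 :
  forall n : nat, (1 <= n)%nat ->
  exists z : R,
    is_alt_zeta_tail n (RtoC 1) (RtoC z) /\
    z <> 0%R /\
    Int_part (/ z) =
      (if Nat.even n then (- 2 * Z.of_nat n)%Z else (2 * Z.of_nat n - 1)%Z).
Proof.
intros n Hn.
destruct (ex_series_alt_harmonic_tail n Hn) as [l Hl].
assert (Hn1 : 1 <= INR n) by (apply (le_INR 1); lia).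
destruct (alt_harmonic_tail_bounds n l Hn Hl) as [Hlo Hhi].
assert (Hl0 : 0 < l).
{ apply Rlt_trans with (2 := Hlo); apply Rinv_0_lt_compat; lra. }
assert (Hinv_hi : / l < 2 * INR n).
{ rewrite <- (Rinv_inv (2 * INR n)).
  apply Rinv_lt_contravar; [| exact Hlo].
  apply Rmult_lt_0_compat; [apply Rinv_0_lt_compat |]; lra. }
assert (Hinv_lo : 2 * INR n - 1 < / l).
{ rewrite <- (Rinv_inv (2 * INR n - 1)).
  apply Rinv_lt_contravar; [| exact Hhi].
  apply Rmult_lt_0_compat; [| apply Rinv_0_lt_compat]; lra. }
(* The factor restores the sign of the leading term, as [(-1)^(n+j+1) = (-1)^(n+1) * (-1)^j]. *)
exists ((-1) ^ (n + 1) * l); split; [| split].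
- unfold is_alt_zeta_tail.
  apply is_series_ext
    with (fun j => RtoC ((-1) ^ (n + 1) * ((-1) ^ j / INR (n + j)))).
  { intros j; rewrite alt_zeta_term_1 by lia.
    f_equal; rewrite !pow_add; unfold Rdiv; ring. }
  apply is_series_RtoC.
  exact (is_series_scal_l ((-1) ^ (n + 1)) _ _ Hl).
- apply Rmult_integral_contrapositive; split; [apply pow_nonzero |]; lra.
- symmetry; destruct (Nat.even n) eqn:E.
  (* For even [n] the inverse is [-1/l], strictly between [-2n] and [-2n+1]. *)
  + apply Nat.even_spec in E; destruct E as [m E].
    replace (n + 1)%nat with (S (2 * m)) by lia.
    rewrite pow_1_odd.
    replace (/ (-1 * l)) with (- / l) by (field; lra).
    apply Int_part_spec.
    rewrite mult_IZR, <- INR_IZR_INZ; lra.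
  (* For odd [n] the inverse is [1/l] itself, strictly between [2n-1] and [2n]. *)
  + assert (O : Nat.odd n = true) by now rewrite <- Nat.negb_even, E.
    apply Nat.odd_spec in O; destruct O as [m O].
    replace (n + 1)%nat with (2 * S m)%nat by lia.
    rewrite pow_1_even, Rmult_1_l.
    apply Int_part_spec.
    rewrite minus_IZR, mult_IZR, <- INR_IZR_INZ; lra.
Qed.
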